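(* Let $(R,1_R)$ be a unital Riesz space in which every strictly positive element is a strong unit, and let $M$ be a pseudo MV-algebra. For every state $m$ on $M$, the map $s(x):=m(x)1_R$ is an $(R,1_R)$-state on $M$. Conversely, for every $(R,1_R)$-state $s$ on $M$ there is a unique state $m_s$ on $M$ with $s(x)=m_s(x)1_R$ for all $x\in M$, and $s\mapsto m_s$ is an affine bijection from the set of $(R,1_R)$-states onto the set of states on $M$. Moreover, for an $(R,1_R)$-state $s$ the following are equivalent: (i) $s$ is extremal; (ii) $s$ is an $(R,1_R)$-state-morphism; (iii) $s(x\wedge y)=s(x)\wedge s(y)$ for all $x,y\in M$; (iv) $m_s$ is a state-morphism on $M$.
   Context: Pseudo MV-algebra: an algebra $(M;\oplus,{}^-,{}^\sim,0,1)$, $0\neq1$, satisfying the standard pseudo MV-algebra axioms; equivalently (up to isomorphism) $M=\Gamma(G,u)=[0,u]$ for a unital $\ell$-group $(G,u)$ with $x\oplus y=(x+y)\wedge u$, $x^-=u-x$, $x^\sim=-x+u$, $x\odot y=(x-u+y)\vee0$, lattice order from $G$. Partial addition: $x+y$ defined iff $x\odot y=0$, then $x+y=x\oplus y$. For a unital Riesz space $(R,1_R)$ (Riesz space with fixed strong unit $1_R$), $\Gamma(R,1_R)$ is the MV-algebra on $[0,1_R]$. An $(R,1_R)$-state on $M$ is a map $s:M\to[0,1_R]$ with $s(1)=1_R$, $s(x+y)=s(x)+s(y)$ whenever $x+y$ is defined; a state is an $(\mathbb R,1)$-state. An $(R,1_R)$-state-morphism is a pseudo MV-algebra homomorphism $M\to\Gamma(R,1_R)$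 (state-morphism when $R=\mathbb R$, $1_R=1$). Extremal: $s=\lambda s_1+(1-\lambda)s_2$ with $\lambda\in(0,1)$ and $(R,1_R)$-states $s_1,s_2$ implies $s_1=s_2$. *)

(* Defs.v *)
From Stdlib Require Import Reals.
Open Scope R_scope.

(* ---------- Pseudo MV-algebras (Georgescu--Iorgulescu axioms) ---------- *)
Record pseudoMV := PseudoMV {
  pmv_car :> Type;
  pmv_oplus : pmv_car -> pmv_car -> pmv_car;
  pmv_minus : pmv_car -> pmv_car;
  pmv_tilde : pmv_car -> pmv_car;
  pmv_zero : pmv_car;
  pmv_one : pmv_car;
  pmv_zero_neq_one : pmv_zero <> pmv_one;
  pmv_A1 : forall x y z, pmv_oplus x (pmv_oplus y z) = pmv_oplus (pmv_oplus x y) z;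
  pmv_A2 : forall x, pmv_oplus x pmv_zero = x /\ pmv_oplus pmv_zero x = x;
  pmv_A3 : forall x, pmv_oplus x pmv_one = pmv_one /\ pmv_oplus pmv_one x = pmv_one;
  pmv_A4 : pmv_tilde pmv_one = pmv_zero /\ pmv_minus pmv_one = pmv_zero;
  pmv_A5 : forall x y, pmv_tilde (pmv_oplus (pmv_minus x) (pmv_minus y))
                     = pmv_minus (pmv_oplus (pmv_tilde x) (pmv_tilde y));
  pmv_A6 : forall x y,
    let odot a b := pmv_tilde (pmv_oplus (pmv_minus b) (pmv_minus a)) in
    pmv_oplus x (odot (pmv_tilde x) y) = pmv_oplus y (odot (pmv_tilde y) x) /\
    pmv_oplus y (odot (pmv_tilde y) x) = pmv_oplus (odot x (pmv_minus y)) y /\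
    pmv_oplus (odot x (pmv_minus y)) y = pmv_oplus (odot y (pmv_minus x)) x;
  pmv_A7 : forall x y,
    let odot a b := pmv_tilde (pmv_oplus (pmv_minus b) (pmv_minus a)) in
    odot x (pmv_oplus (pmv_minus x) y) = odot (pmv_oplus x (pmv_tilde y)) y;
  pmv_A8 : forall x, pmv_tilde (pmv_minus x) = x
}.

Arguments pmv_oplus {_}.
Arguments pmv_minus {_}.
Arguments pmv_tilde {_}.
Arguments pmv_zero {_}.
Arguments pmv_one {_}.

(* x (.) y := (y^- (+) x^-)^~ ; in Gamma(G,u) this is (x - u + y) \/ 0 *)
Definition pmv_odot {M : pseudoMV} (x y : M) : M :=
  pmv_tilde (pmv_oplus (pmv_minus y) (pmv_minus x)).

Definition pmv_meet {M : pseudoMV} (x y : M) : M :=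
  pmv_odot x (pmv_oplus (pmv_minus x) y).

(* partial addition x + y is defined iff x <= y^-, i.e. y (.) x = 0
   (in Gamma(G,u): iff x + y <= u in G); then x + y = x (+) y *)
Definition pmv_sum_defined {M : pseudoMV} (x y : M) : Prop :=
  pmv_odot y x = pmv_zero.

Record RieszSpace := Riesz {
  rs_car :> Type;
  rs_add : rs_car -> rs_car -> rs_car;
  rs_opp : rs_car -> rs_car;
  rs_zero : rs_car;
  rs_scal : R -> rs_car -> rs_car;
  rs_le : rs_car -> rs_car -> Prop;
  rs_meet : rs_car -> rs_car -> rs_car;
  rs_join : rs_car -> rs_car -> rs_car;
  rs_addA : forall a b c, rs_add a (rs_add b c) = rs_add (rs_add a b) c;
  rs_addC : forall a b, rs_add a b = rs_add b a;
  rs_add0 : forall a, rs_add a rs_zero = a;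
  rs_addN : forall a, rs_add a (rs_opp a) = rs_zero;
  rs_scalA : forall (r t : R) a, rs_scal r (rs_scal t a) = rs_scal (r * t) a;
  rs_scal1 : forall a, rs_scal 1 a = a;
  rs_scalDr : forall r a b, rs_scal r (rs_add a b) = rs_add (rs_scal r a) (rs_scal r b);
  rs_scalDl : forall r t a, rs_scal (r + t) a = rs_add (rs_scal r a) (rs_scal t a);
  rs_le_refl : forall a, rs_le a a;
  rs_le_antisym : forall a b, rs_le a b -> rs_le b a -> a = b;
  rs_le_trans : forall a b c, rs_le a b -> rs_le b c -> rs_le a c;
  rs_le_add : forall a b c, rs_le a b -> rs_le (rs_add a c) (rs_add b c);
  rs_le_scal : forall r a b, 0 <= r -> rs_le a b -> rs_le (rs_scal r a) (rs_scal r b);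
  rs_meet_l : forall a b, rs_le (rs_meet a b) a;
  rs_meet_r : forall a b, rs_le (rs_meet a b) b;
  rs_meet_glb : forall a b c, rs_le c a -> rs_le c b -> rs_le c (rs_meet a b);
  rs_join_l : forall a b, rs_le a (rs_join a b);
  rs_join_r : forall a b, rs_le b (rs_join a b);
  rs_join_lub : forall a b c, rs_le a c -> rs_le b c -> rs_le (rs_join a b) c
}.

Arguments rs_add {_}.
Arguments rs_opp {_}.
Arguments rs_zero {_}.
Arguments rs_scal {_}.
Arguments rs_le {_}.
Arguments rs_meet {_}.
Arguments rs_join {_}.

Definition rs_sub {V : RieszSpace} (a b : V) : V := rs_add a (rs_opp b).

Definition rs_strictly_pos {V : RieszSpace} (a : V) : Prop :=
  rs_le rs_zero a /\ a <> rs_zero.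

Definition strong_unit {V : RieszSpace} (u : V) : Prop :=
  rs_strictly_pos u /\ forall v : V, exists n : nat, rs_le v (rs_scal (INR n) u).

Definition is_RState {M : pseudoMV} {V : RieszSpace} (u : V) (s : M -> V) : Prop :=
  (forall x, rs_le rs_zero (s x) /\ rs_le (s x) u) /\
  s pmv_one = u /\
  (forall x y, pmv_sum_defined x y -> s (pmv_oplus x y) = rs_add (s x) (s y)).

Definition is_state {M : pseudoMV} (m : M -> R) : Prop :=
  (forall x, 0 <= m x <= 1) /\
  m pmv_one = 1 /\
  (forall x y, pmv_sum_defined x y -> m (pmv_oplus x y) = m x + m y).

(* (V,u)-state-morphism: pseudo MV-homomorphism M -> Gamma(V,u);
   in Gamma(V,u): a (+) b = (a+b) /\ u, a^- = a^~ = u - a, 0, u *)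
Definition is_RState_morphism {M : pseudoMV} {V : RieszSpace} (u : V) (s : M -> V) : Prop :=
  (forall x, rs_le rs_zero (s x) /\ rs_le (s x) u) /\
  (forall x y, s (pmv_oplus x y) = rs_meet (rs_add (s x) (s y)) u) /\
  (forall x, s (pmv_minus x) = rs_sub u (s x)) /\
  (forall x, s (pmv_tilde x) = rs_sub u (s x)) /\
  s pmv_zero = rs_zero /\
  s pmv_one = u.

Definition is_state_morphism {M : pseudoMV} (m : M -> R) : Prop :=
  (forall x, 0 <= m x <= 1) /\
  (forall x y, m (pmv_oplus x y) = Rmin (m x + m y) 1) /\
  (forall x, m (pmv_minus x) = 1 - m x) /\
  (forall x, m (pmv_tilde x) = 1 - m x) /\
  m pmv_zero = 0 /\
  m pmv_one = 1.

Definition rs_comb {M : pseudoMV} {V : RieszSpace} (l : R) (s1 s2 : M -> V) : M -> V :=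
  fun x => rs_add (rs_scal l (s1 x)) (rs_scal (1 - l) (s2 x)).

Definition is_extremal_RState {M : pseudoMV} {V : RieszSpace} (u : V) (s : M -> V) : Prop :=
  is_RState u s /\
  forall (l : R) (s1 s2 : M -> V), 0 < l < 1 ->
    is_RState u s1 -> is_RState u s2 ->
    (forall x, s x = rs_comb l s1 s2 x) ->
    forall x, s1 x = s2 x.

(* Main.v *)
(** The order of [V] is total (for [p = a \/ 0] and [q = (-a) \/ 0] one has
    [p /\ q = 0], which is impossible for two strong units) and archimedean,
    so every element of [[0,u]] is a real multiple of [u], and everything
    reduces to real-valued states.

    An extremal state [f] preserves meets: if [x /\ y = 0], then
    [g z = sup_n f (z /\ n.x)] is additive with [0 <= g <= f], so by extremality
    [g = g(1) f]; since [g x = f x] and [g y = 0], [f x = 0] or [f y = 0]. The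
    general case follows by subtracting [x /\ y] from [x] and [y].

    Conversely, let [m] be a state-morphism and [s] a state vanishing wherever
    [m] does. Starting from [0], repeatedly add [x] by [(+)] or [(.)], according
    to whether the sum of the [m]-values is below or above [1]. The k-th element
    [y] satisfies [m y = k m(x) - c] and [s y = k s(x) - c] with the same [c], so
    [k |m(x) - s(x)| <= 1] for all [k], hence [s = m]. *)

Require Import Defs.
From Stdlib Require Import Reals Lra Lia Classical ClassicalEpsilon.
Open Scope R_scope.

(** * Pseudo MV-algebras *)

Definition pmv_le {M : pseudoMV} (x y : M) : Prop :=
  pmv_oplus (pmv_minus x) y = pmv_one.

(** A5 at [y = 1] loses both summands coming from [1] and says that the two double complements of
    [x] agree; A8 evaluates one of them. *)
Lemma pmv_tilde_minus (M : pseudoMV) (x : M) : pmv_minus (pmv_tilde x) = x.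
Proof.
  pose proof (pmv_A5 M x pmv_one) as H.
  destruct (pmv_A4 M) as [T1 M1].
  rewrite T1, M1 in H.
  rewrite (proj1 (pmv_A2 M (pmv_minus x))), (proj1 (pmv_A2 M (pmv_tilde x))), pmv_A8 in H.
  now symmetry.
Qed.

Lemma pmv_minus_zero (M : pseudoMV) : pmv_minus (pmv_zero : M) = pmv_one.
Proof. rewrite <- (proj1 (pmv_A4 M)). apply pmv_tilde_minus. Qed.

Lemma pmv_odot_minusE (M : pseudoMV) (x y : M) :
  pmv_odot x y = pmv_minus (pmv_oplus (pmv_tilde y) (pmv_tilde x)).
Proof. apply pmv_A5. Qed.

Lemma pmv_minus_odot (M : pseudoMV) (x y : M) :
  pmv_minus (pmv_odot x y) = pmv_oplus (pmv_minus y) (pmv_minus x).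
Proof. apply pmv_tilde_minus. Qed.

Lemma pmv_tilde_odot (M : pseudoMV) (x y : M) :
  pmv_tilde (pmv_odot x y) = pmv_oplus (pmv_tilde y) (pmv_tilde x).
Proof. rewrite pmv_odot_minusE. apply pmv_A8. Qed.

Lemma pmv_odot_one_r (M : pseudoMV) (x : M) : pmv_odot x pmv_one = x.
Proof.
  unfold pmv_odot. rewrite (proj2 (pmv_A4 M)), (proj2 (pmv_A2 M _)). apply pmv_A8.
Qed.

Lemma pmv_odot_one_l (M : pseudoMV) (x : M) : pmv_odot pmv_one x = x.
Proof.
  unfold pmv_odot. rewrite (proj2 (pmv_A4 M)), (proj1 (pmv_A2 M _)). apply pmv_A8.
Qed.

Lemma pmv_odot_zero_r (M : pseudoMV) (x : M) : pmv_odot x pmv_zero = pmv_zero.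
Proof.
  unfold pmv_odot. rewrite pmv_minus_zero, (proj2 (pmv_A3 M _)). apply (pmv_A4 M).
Qed.

Lemma pmv_join_oplus (M : pseudoMV) (x y : M) :
  pmv_oplus x (pmv_odot (pmv_tilde x) y) = pmv_oplus y (pmv_odot (pmv_tilde y) x).
Proof. apply (pmv_A6 M x y). Qed.

(** The complement of [x] is its own product with [1], so exchanging the arguments of the join puts
    [1] in front of the sum. *)
Lemma pmv_oplus_tilde (M : pseudoMV) (x : M) : pmv_oplus x (pmv_tilde x) = pmv_one.
Proof.
  rewrite <- (pmv_odot_one_r M (pmv_tilde x)), pmv_join_oplus. apply pmv_A3.
Qed.

Lemma pmv_minus_oplus (M : pseudoMV) (x : M) : pmv_oplus (pmv_minus x) x = pmv_one.
Proof.
  rewrite <- (pmv_A8 M x) at 2. apply pmv_oplus_tilde.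
Qed.

Lemma pmv_join_oplus_r (M : pseudoMV) (x y : M) :
  pmv_oplus x (pmv_odot (pmv_tilde x) y) = pmv_oplus (pmv_odot x (pmv_minus y)) y.
Proof.
  destruct (pmv_A6 M x y) as [H1 [H2 _]]. exact (eq_trans H1 H2).
Qed.

(** * Natural order, differences and meets *)

Lemma pmv_le_odot (M : pseudoMV) (x y : M) :
  pmv_le x y -> pmv_odot (pmv_tilde y) x = pmv_zero.
Proof.
  intros H. unfold pmv_odot. rewrite pmv_tilde_minus, H. apply (pmv_A4 M).
Qed.

(** In [Gamma(G,u)] the element [x^~ (.) y] is the difference [-x + y]. Written from the side of
    [y], the same join has remainder zero. *)
Lemma pmv_le_split (M : pseudoMV) (x y : M) :
  pmv_le x y -> pmv_oplus x (pmv_odot (pmv_tilde x) y) = y.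
Proof.
  intros H. rewrite pmv_join_oplus, (pmv_le_odot M x y H). apply pmv_A2.
Qed.

Lemma pmv_le_oplus_l (M : pseudoMV) (x z : M) : pmv_le x (pmv_oplus x z).
Proof. unfold pmv_le. rewrite pmv_A1, pmv_minus_oplus. apply pmv_A3. Qed.

(** The order does not depend on the side from which it is defined. For the converse, [x (.) y^-]
    vanishes, so the join is [y], and it also has the form [x (+) z]. *)
Lemma pmv_le_tildeE (M : pseudoMV) (x y : M) :
  pmv_le x y <-> pmv_oplus y (pmv_tilde x) = pmv_one.
Proof.
  split; intros H.
  - rewrite <- (pmv_le_split M x y H), pmv_join_oplus, pmv_join_oplus_r.
    rewrite <- pmv_A1, pmv_oplus_tilde. apply pmv_A3.
  - assert (E : pmv_odot x (pmv_minus y) = pmv_zero).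
    { rewrite pmv_odot_minusE, pmv_A8, H. apply (pmv_A4 M). }
    pose proof (pmv_join_oplus_r M x y) as J.
    rewrite E, (proj2 (pmv_A2 M y)) in J.
    rewrite <- J. apply pmv_le_oplus_l.
Qed.

Lemma pmv_le_oplus_r (M : pseudoMV) (x z : M) : pmv_le x (pmv_oplus z x).
Proof.
  apply pmv_le_tildeE. rewrite <- pmv_A1, pmv_oplus_tilde. apply pmv_A3.
Qed.

Lemma pmv_le_refl (M : pseudoMV) (x : M) : pmv_le x x.
Proof. apply pmv_minus_oplus. Qed.

Lemma pmv_le_trans (M : pseudoMV) (x y z : M) : pmv_le x y -> pmv_le y z -> pmv_le x z.
Proof.
  intros Hxy Hyz.
  rewrite <- (pmv_le_split M y z Hyz), <- (pmv_le_split M x y Hxy), <- pmv_A1.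
  apply pmv_le_oplus_l.
Qed.

Lemma pmv_le_antisym (M : pseudoMV) (x y : M) : pmv_le x y -> pmv_le y x -> x = y.
Proof.
  intros Hxy Hyx.
  rewrite <- (pmv_le_split M x y Hxy), (pmv_le_odot M y x Hyx).
  symmetry. apply pmv_A2.
Qed.

Lemma pmv_le_one (M : pseudoMV) (x : M) : pmv_le x pmv_one.
Proof. apply pmv_A3. Qed.

Lemma pmv_le_zero (M : pseudoMV) (x : M) : pmv_le pmv_zero x.
Proof. unfold pmv_le. rewrite pmv_minus_zero. apply pmv_A3. Qed.

Lemma pmv_oplus_le_r (M : pseudoMV) (a b c : M) :
  pmv_le a b -> pmv_le (pmv_oplus c a) (pmv_oplus c b).
Proof.
  intros H. rewrite <- (pmv_le_split M a b H), pmv_A1. apply pmv_le_oplus_l.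
Qed.

Lemma pmv_oplus_le_l (M : pseudoMV) (a b c : M) :
  pmv_le a b -> pmv_le (pmv_oplus a c) (pmv_oplus b c).
Proof.
  intros H. rewrite <- (pmv_le_split M a b H), pmv_join_oplus, pmv_join_oplus_r, <- pmv_A1.
  apply pmv_le_oplus_r.
Qed.

Lemma pmv_oplus_le (M : pseudoMV) (a b c d : M) :
  pmv_le a b -> pmv_le c d -> pmv_le (pmv_oplus a c) (pmv_oplus b d).
Proof.
  intros H1 H2. apply pmv_le_trans with (pmv_oplus b c).
  - now apply pmv_oplus_le_l.
  - now apply pmv_oplus_le_r.
Qed.

Lemma pmv_le_minus (M : pseudoMV) (x y : M) :
  pmv_le x y -> pmv_le (pmv_minus y) (pmv_minus x).
Proof. intros H. apply pmv_le_tildeE. rewrite pmv_A8. exact H. Qed.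

Lemma pmv_le_tilde (M : pseudoMV) (x y : M) :
  pmv_le x y -> pmv_le (pmv_tilde y) (pmv_tilde x).
Proof. intros H. apply pmv_le_tildeE in H. unfold pmv_le. now rewrite pmv_tilde_minus. Qed.

Lemma pmv_odot_le_r (M : pseudoMV) (a b c : M) :
  pmv_le a b -> pmv_le (pmv_odot c a) (pmv_odot c b).
Proof. intros H. apply pmv_le_tilde, pmv_oplus_le_l, pmv_le_minus, H. Qed.

Lemma pmv_odot_le_l (M : pseudoMV) (a b c : M) :
  pmv_le a b -> pmv_le (pmv_odot a c) (pmv_odot b c).
Proof. intros H. apply pmv_le_tilde, pmv_oplus_le_r, pmv_le_minus, H. Qed.

Lemma pmv_odot_lel (M : pseudoMV) (x w : M) : pmv_le (pmv_odot x w) x.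
Proof. rewrite <- (pmv_odot_one_r M x) at 2. apply pmv_odot_le_r, pmv_le_one. Qed.

Lemma pmv_odot_ler (M : pseudoMV) (x w : M) : pmv_le (pmv_odot w x) x.
Proof. rewrite <- (pmv_odot_one_l M x) at 2. apply pmv_odot_le_l, pmv_le_one. Qed.

Lemma pmv_meetE (M : pseudoMV) (x y : M) :
  pmv_meet x y = pmv_odot (pmv_oplus x (pmv_tilde y)) y.
Proof. apply pmv_A7. Qed.

Lemma pmv_meet_lel (M : pseudoMV) (x y : M) : pmv_le (pmv_meet x y) x.
Proof. apply pmv_odot_lel. Qed.

Lemma pmv_meet_ler (M : pseudoMV) (x y : M) : pmv_le (pmv_meet x y) y.
Proof. rewrite pmv_meetE. apply pmv_odot_ler. Qed.

Lemma pmv_meet_glb (M : pseudoMV) (x y z : M) :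
  pmv_le z x -> pmv_le z y -> pmv_le z (pmv_meet x y).
Proof.
  intros Hx Hy.
  (* A [z] below [x] is already [pmv_meet x z], and the meet is monotone in its second argument. *)
  assert (E : z = pmv_meet x z).
  { rewrite pmv_meetE, (proj1 (pmv_le_tildeE M z x) Hx), pmv_odot_one_l. reflexivity. }
  rewrite E. apply pmv_odot_le_r, pmv_oplus_le_r, Hy.
Qed.

Lemma pmv_meet_idr (M : pseudoMV) (x y : M) : pmv_le y x -> pmv_meet x y = y.
Proof.
  intros H. apply pmv_le_antisym.
  - apply pmv_meet_ler.
  - apply pmv_meet_glb; [exact H | apply pmv_le_refl].
Qed.

Lemma pmv_meet_idl (M : pseudoMV) (x y : M) : pmv_le x y -> pmv_meet x y = x.
Proof.
  intros H. apply pmv_le_antisym.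
  - apply pmv_meet_lel.
  - apply pmv_meet_glb; [apply pmv_le_refl | exact H].
Qed.

(** Both inequalities say that [z (+) c (+) t^~] equals [1], up to bracketing. *)
Lemma pmv_residual_r (M : pseudoMV) (t z c : M) :
  pmv_le t (pmv_oplus z c) <-> pmv_le (pmv_odot t (pmv_minus c)) z.
Proof.
  rewrite !pmv_le_tildeE, pmv_tilde_odot, pmv_A8, pmv_A1. reflexivity.
Qed.

Lemma pmv_residual_l (M : pseudoMV) (t z c : M) :
  pmv_le t (pmv_oplus c z) <-> pmv_le (pmv_odot (pmv_tilde c) t) z.
Proof.
  unfold pmv_le. rewrite pmv_minus_odot, pmv_tilde_minus, pmv_A1. reflexivity.
Qed.

(** The right-hand side is the meet of [a (+) b], [a (+) c], [c (+) b] and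
    [c (+) c]; residuation gives this without proving distributivity. *)
Lemma pmv_meet_oplus_le (M : pseudoMV) (a b c : M) :
  pmv_le (pmv_meet (pmv_oplus a b) c) (pmv_oplus (pmv_meet a c) (pmv_meet b c)).
Proof.
  apply pmv_residual_r, pmv_meet_glb; apply pmv_residual_r, pmv_residual_l, pmv_meet_glb;
    apply pmv_residual_l.
  - apply pmv_meet_lel.
  - apply pmv_le_trans with c; [apply pmv_meet_ler | apply pmv_le_oplus_r].
  - apply pmv_le_trans with c; [apply pmv_meet_ler | apply pmv_le_oplus_l].
  - apply pmv_le_trans with c; [apply pmv_meet_ler | apply pmv_le_oplus_l].
Qed.

(** * Partial sums and cancellation *)

Lemma pmv_sum_definedE (M : pseudoMV) (x y : M) :
  pmv_sum_defined x y <-> pmv_le x (pmv_minus y).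
Proof.
  unfold pmv_sum_defined, pmv_le. split; intros H.
  - rewrite <- (pmv_minus_odot M y x), H. apply pmv_minus_zero.
  - unfold pmv_odot. rewrite H. apply (pmv_A4 M).
Qed.

Lemma pmv_sum_defined_tildeE (M : pseudoMV) (x y : M) :
  pmv_sum_defined x y <-> pmv_le y (pmv_tilde x).
Proof.
  rewrite pmv_sum_definedE. split; intros H.
  - apply pmv_le_tilde in H. now rewrite pmv_A8 in H.
  - apply pmv_le_minus in H. now rewrite pmv_tilde_minus in H.
Qed.

Lemma pmv_sum_defined_le (M : pseudoMV) (x y x' y' : M) :
  pmv_le x' x -> pmv_le y' y -> pmv_sum_defined x y -> pmv_sum_defined x' y'.
Proof.
  rewrite !pmv_sum_definedE. intros Hx Hy H.
  apply pmv_le_trans with x; [exact Hx |].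
  apply pmv_le_trans with (pmv_minus y); [exact H | now apply pmv_le_minus].
Qed.

Lemma pmv_sum_defined_diff (M : pseudoMV) (x y : M) :
  pmv_sum_defined x (pmv_odot (pmv_tilde x) y).
Proof. apply pmv_sum_defined_tildeE, pmv_odot_lel. Qed.

(** Only the part of [y] below [x^~] fits on top of [x]. This turns any [(+)] into a defined partial
    sum, on which additive maps can be evaluated. *)
Lemma pmv_oplus_meet_tilde (M : pseudoMV) (x y : M) :
  pmv_oplus x (pmv_meet (pmv_tilde x) y) = pmv_oplus x y.
Proof.
  unfold pmv_meet. rewrite pmv_tilde_minus. apply pmv_le_split, pmv_le_oplus_l.
Qed.

(** Since [d] lies below [a^~], it equals [a^~ /\ d = a^~ (.) (a (+) d)], which is at most
    [a^~ (.) a = 0]. *)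
Lemma pmv_sum_cancel_zero (M : pseudoMV) (a d : M) :
  pmv_sum_defined a d -> pmv_le (pmv_oplus a d) a -> d = pmv_zero.
Proof.
  intros Hd H. apply pmv_sum_defined_tildeE in Hd.
  apply pmv_le_antisym; [| apply pmv_le_zero].
  rewrite <- (pmv_meet_idr M _ _ Hd). unfold pmv_meet. rewrite pmv_tilde_minus.
  rewrite <- (pmv_le_odot M _ _ (pmv_le_refl M a)). now apply pmv_odot_le_r.
Qed.

(** Put back on top of [x /\ y], the meet of the two differences yields a lower bound of [x] and
    [y], hence an element below [x /\ y]; cancellation leaves zero. *)
Lemma pmv_diff_disjoint (M : pseudoMV) (x y : M) :
  pmv_meet (pmv_odot (pmv_tilde (pmv_meet x y)) x)
           (pmv_odot (pmv_tilde (pmv_meet x y)) y) = pmv_zero.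
Proof.
  apply pmv_sum_cancel_zero with (pmv_meet x y).
  - apply pmv_sum_defined_le with (1 := pmv_le_refl M _) (2 := pmv_meet_lel M _ _).
    apply pmv_sum_defined_diff.
  - apply pmv_meet_glb.
    + eapply pmv_le_trans; [apply pmv_oplus_le_r, pmv_meet_lel |].
      rewrite (pmv_le_split M _ _ (pmv_meet_lel M x y)). apply pmv_le_refl.
    + eapply pmv_le_trans; [apply pmv_oplus_le_r, pmv_meet_ler |].
      rewrite (pmv_le_split M _ _ (pmv_meet_ler M x y)). apply pmv_le_refl.
Qed.

(** * Truncated multiples *)

Fixpoint pmv_mul {M : pseudoMV} (n : nat) (x : M) : M :=
  match n with
  | O => pmv_zero
  | S k => pmv_oplus x (pmv_mul k x)
  end.

Lemma pmv_mul_add (M : pseudoMV) (n k : nat) (x : M) :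
  pmv_mul (n + k) x = pmv_oplus (pmv_mul n x) (pmv_mul k x).
Proof.
  induction n as [|n IH]; simpl.
  - symmetry. apply pmv_A2.
  - now rewrite IH, pmv_A1.
Qed.

Lemma pmv_meetC (M : pseudoMV) (x y : M) : pmv_meet x y = pmv_meet y x.
Proof.
  apply pmv_le_antisym; apply pmv_meet_glb;
    (apply pmv_meet_lel || apply pmv_meet_ler).
Qed.

Lemma pmv_meet_mul_zero (M : pseudoMV) (n : nat) (x y : M) :
  pmv_meet x y = pmv_zero -> pmv_meet (pmv_mul n x) y = pmv_zero.
Proof.
  intros H. induction n as [|n IH]; simpl.
  - apply pmv_meet_idl, pmv_le_zero.
  - apply pmv_le_antisym; [| apply pmv_le_zero].
    pose proof (pmv_meet_oplus_le M x (pmv_mul n x) y) as L.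
    now rewrite H, IH, (proj1 (pmv_A2 M pmv_zero)) in L.
Qed.

(** * Real-valued states *)

Definition pmv_additive {M : pseudoMV} (f : M -> R) : Prop :=
  forall x y, pmv_sum_defined x y -> f (pmv_oplus x y) = f x + f y.

Lemma additive_zero (M : pseudoMV) (f : M -> R) : pmv_additive f -> f pmv_zero = 0.
Proof.
  intros Hf. assert (D : pmv_sum_defined (pmv_zero : M) pmv_zero) by apply pmv_odot_zero_r.
  pose proof (Hf _ _ D) as H. rewrite (proj1 (pmv_A2 M _)) in H. lra.
Qed.

Lemma additive_diff (M : pseudoMV) (f : M -> R) (x y : M) :
  pmv_additive f -> pmv_le x y -> f y = f x + f (pmv_odot (pmv_tilde x) y).
Proof.
  intros Hf Hxy. rewrite <- (Hf _ _ (pmv_sum_defined_diff M x y)).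
  now rewrite pmv_le_split.
Qed.

Lemma additive_le (M : pseudoMV) (f : M -> R) (x y : M) :
  pmv_additive f -> (forall z, 0 <= f z) -> pmv_le x y -> f x <= f y.
Proof.
  intros Hf Hp Hxy. rewrite (additive_diff M f x y Hf Hxy).
  specialize (Hp (pmv_odot (pmv_tilde x) y)). lra.
Qed.

Lemma additive_oplus (M : pseudoMV) (f : M -> R) (x y : M) :
  pmv_additive f -> f (pmv_oplus x y) = f x + f (pmv_meet (pmv_tilde x) y).
Proof.
  intros Hf. rewrite <- pmv_oplus_meet_tilde. apply Hf.
  apply pmv_sum_defined_tildeE, pmv_meet_lel.
Qed.

Lemma state_tilde (M : pseudoMV) (m : M -> R) (x : M) :
  is_state m -> m (pmv_tilde x) = 1 - m x.
Proof.
  intros [_ [H1 Ha]].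
  assert (D : pmv_sum_defined x (pmv_tilde x)) by apply pmv_sum_defined_tildeE, pmv_le_refl.
  pose proof (Ha _ _ D) as H. rewrite pmv_oplus_tilde in H. lra.
Qed.

Lemma state_minus (M : pseudoMV) (m : M -> R) (x : M) :
  is_state m -> m (pmv_minus x) = 1 - m x.
Proof.
  intros Hm. pose proof (state_tilde M m (pmv_minus x) Hm) as H.
  rewrite pmv_A8 in H. lra.
Qed.

Lemma additive_normalize (M : pseudoMV) (g : M -> R) :
  pmv_additive g -> (forall x, 0 <= g x) -> 0 < g pmv_one ->
  is_state (fun x => g x / g pmv_one).
Proof.
  intros Ha Hp H1. split; [|split].
  - intros x. pose proof (additive_le M g x pmv_one Ha Hp (pmv_le_one M x)) as L.
    split.
    + apply Rle_mult_inv_pos; [apply Hp | exact H1].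
    + apply Rmult_le_reg_r with (g pmv_one); [exact H1 |].
      unfold Rdiv. rewrite Rmult_assoc, Rinv_l by lra. lra.
  - field. lra.
  - intros x y D. rewrite (Ha x y D). field. lra.
Qed.

(** * Extremal states preserve meets *)

Definition is_extremal_state {M : pseudoMV} (m : M -> R) : Prop :=
  forall (l : R) (m1 m2 : M -> R), 0 < l < 1 -> is_state m1 -> is_state m2 ->
    (forall x, m x = l * m1 x + (1 - l) * m2 x) -> forall x, m1 x = m2 x.

(** With [h = f - g], the state [f] is the mixture of the normalizations of [g] and [h] with weights
    [g(1)] and [h(1)]. Extremality makes these two states equal, and clearing denominators gives the
    formula. *)
Lemma extremal_dominated (M : pseudoMV) (f g : M -> R) :
  is_state f -> is_extremal_state f -> pmv_additive g -> (forall x, 0 <= g x <= f x) ->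
  forall x, g x = g pmv_one * f x.
Proof.
  intros Hf He Hg Hb.
  assert (Hg0 : forall x, 0 <= g x) by (intros x; apply Hb).
  set (h := fun x => f x - g x).
  assert (Hh : pmv_additive h).
  { intros x y D. unfold h. rewrite (proj2 (proj2 Hf) x y D), (Hg x y D). ring. }
  assert (Hh0 : forall x, 0 <= h x) by (intros x; unfold h; specialize (Hb x); lra).
  pose proof (proj1 (proj2 Hf)) as Hf1.
  assert (Hh1 : h pmv_one = 1 - g pmv_one) by (unfold h; lra).
  pose proof (Hg0 pmv_one) as P1. pose proof (Hh0 pmv_one) as P2.
  (* Normalizing requires both weights to be nonzero. At [g(1) = 0] monotonicity gives [g = 0], and
     at [g(1) = 1] it gives [h = 0]. *)
  destruct (Req_dec (g pmv_one) 0) as [E0|N0].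
  { intros x. pose proof (additive_le M g x pmv_one Hg Hg0 (pmv_le_one M x)).
    specialize (Hg0 x). rewrite E0 in *. lra. }
  destruct (Req_dec (g pmv_one) 1) as [E1|N1].
  { intros x. pose proof (additive_le M h x pmv_one Hh Hh0 (pmv_le_one M x)) as L.
    specialize (Hh0 x). unfold h in *. rewrite E1. lra. }
  assert (S1 := additive_normalize M g Hg Hg0 ltac:(lra)).
  assert (S2 := additive_normalize M h Hh Hh0 ltac:(lra)).
  intros x.
  assert (E : g x / g pmv_one = h x / h pmv_one).
  { refine (He (g pmv_one) _ _ _ S1 S2 _ x); [lra |].
    intros z. rewrite Hh1. unfold h. field. lra. }
  rewrite Hh1 in E. unfold h in E.
  assert (E' : g x * (1 - g pmv_one) = (f x - g x) * g pmv_one).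
  { replace (g x * (1 - g pmv_one))
      with (g x / g pmv_one * (g pmv_one * (1 - g pmv_one))) by (field; lra).
    rewrite E. field. lra. }
  replace (g x) with (f x * g pmv_one) by lra. ring.
Qed.

Lemma extremal_disjoint (M : pseudoMV) (f : M -> R) (x y : M) :
  is_state f -> is_extremal_state f -> pmv_meet x y = pmv_zero -> f x = 0 \/ f y = 0.
Proof.
  intros Hf He Hxy.
  pose proof (proj2 (proj2 Hf) : pmv_additive f) as Ha.
  assert (Hp : forall z, 0 <= f z) by (intros z; apply (proj1 Hf)).
  set (E := fun z r => exists n, r = f (pmv_meet z (pmv_mul n x))).
  assert (Hbd : forall z, is_upper_bound (E z) (f z)).
  { intros z r [n ->]. apply additive_le; auto. apply pmv_meet_lel. }
  assert (Hlub : forall z, { r | is_lub (E z) r }).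
  { intros z. apply completeness.
    - exists (f z). apply Hbd.
    - exists (f (pmv_meet z (pmv_mul 0 x))). now exists 0%nat. }
  set (g := fun z => proj1_sig (Hlub z)).
  assert (gub : forall z n, f (pmv_meet z (pmv_mul n x)) <= g z).
  { intros z n. unfold g. destruct (Hlub z) as [r [H1 H2]]. simpl. apply H1. now exists n. }
  assert (glub : forall z b, (forall n, f (pmv_meet z (pmv_mul n x)) <= b) -> g z <= b).
  { intros z b H. unfold g. destruct (Hlub z) as [r [H1 H2]]. simpl. apply H2.
    intros r' [n ->]. apply H. }
  assert (Hg : pmv_additive g).
  { intros a b D. apply Rle_antisym.
    (* One [n] serves both summands, since the meet with [n.x] is subdistributive over [(+)]. *)
    - apply glub. intros n.
      assert (D' : pmv_sum_defined (pmv_meet a (pmv_mul n x)) (pmv_meet b (pmv_mul n x)))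
        by (eapply pmv_sum_defined_le; [apply pmv_meet_lel | apply pmv_meet_lel | exact D]).
      pose proof (additive_le M f _ _ Ha Hp (pmv_meet_oplus_le M a b (pmv_mul n x))) as L.
      rewrite (Ha _ _ D') in L. pose proof (gub a n). pose proof (gub b n). lra.
    (* The two suprema are eliminated one after the other, with independent [n] and [k]; the sum of
       the two meets lies below [(n + k).x]. *)
    - assert (K : g a <= g (pmv_oplus a b) - g b); [| lra].
      apply glub. intros n.
      assert (K : g b <= g (pmv_oplus a b) - f (pmv_meet a (pmv_mul n x))); [| lra].
      apply glub. intros k.
      assert (D' : pmv_sum_defined (pmv_meet a (pmv_mul n x)) (pmv_meet b (pmv_mul k x)))
        by (eapply pmv_sum_defined_le; [apply pmv_meet_lel | apply pmv_meet_lel | exact D]).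
      assert (L : pmv_le (pmv_oplus (pmv_meet a (pmv_mul n x)) (pmv_meet b (pmv_mul k x)))
                         (pmv_meet (pmv_oplus a b) (pmv_mul (n + k) x))).
      { apply pmv_meet_glb; [| rewrite pmv_mul_add];
          apply pmv_oplus_le; (apply pmv_meet_lel || apply pmv_meet_ler). }
      pose proof (additive_le M f _ _ Ha Hp L) as L'.
      rewrite (Ha _ _ D') in L'. pose proof (gub (pmv_oplus a b) (n + k)%nat). lra. }
  assert (Hgb : forall z, 0 <= g z <= f z).
  { intros z. split.
    - apply Rle_trans with (2 := gub z 0%nat). apply Hp.
    - apply glub. intros n. apply Hbd. now exists n. }
  pose proof (extremal_dominated M f g Hf He Hg Hgb) as Hl.
  (* The supremum is already attained at [n = 1]. *)
  assert (Hgx : g x = f x).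
  { apply Rle_antisym; [apply Hgb |].
    pose proof (gub x 1%nat) as L. simpl in L.
    now rewrite (proj1 (pmv_A2 M x)), (pmv_meet_idl M x x (pmv_le_refl M x)) in L. }
  assert (Hgy : g y = 0).
  { apply Rle_antisym; [| apply Hgb]. apply glub. intros n.
    rewrite pmv_meetC, (pmv_meet_mul_zero M n x y Hxy), (additive_zero M f Ha). lra. }
  (* Now [g(1) f(y) = 0]; if [g(1) = 0], then [g] vanishes, and with it [f x = g x]. *)
  rewrite Hl in Hgy. apply Rmult_integral in Hgy. destruct Hgy as [E0|E0].
  - left. rewrite <- Hgx, Hl, E0. ring.
  - now right.
Qed.

(** On one of the two disjoint differences [f] vanishes, so [f (x /\ y)] equals [f x] or [f y];
    nonnegativity on the other difference makes it the minimum. *)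
Lemma extremal_state_meet (M : pseudoMV) (f : M -> R) (x y : M) :
  is_state f -> is_extremal_state f -> f (pmv_meet x y) = Rmin (f x) (f y).
Proof.
  intros Hf He.
  pose proof (proj2 (proj2 Hf) : pmv_additive f) as Ha.
  pose proof (additive_diff M f _ _ Ha (pmv_meet_lel M x y)) as Ex.
  pose proof (additive_diff M f _ _ Ha (pmv_meet_ler M x y)) as Ey.
  pose proof (proj1 Hf (pmv_odot (pmv_tilde (pmv_meet x y)) x)) as Px.
  pose proof (proj1 Hf (pmv_odot (pmv_tilde (pmv_meet x y)) y)) as Py.
  destruct (extremal_disjoint M f _ _ Hf He (pmv_diff_disjoint M x y)) as [E|E].
  - rewrite Rmin_left; lra.
  - rewrite Rmin_right; lra.
Qed.

(** In [m (x (+) y) = m x + m (x^~ /\ y)], preservation of meets turns the last term into the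
    minimum of [1 - m x] and [m y]. *)
Lemma state_meet_morphism (M : pseudoMV) (m : M -> R) :
  is_state m -> (forall x y, m (pmv_meet x y) = Rmin (m x) (m y)) -> is_state_morphism m.
Proof.
  intros Hm Hmeet.
  pose proof (proj2 (proj2 Hm) : pmv_additive m) as Ha.
  split; [apply Hm |]. split; [|split; [|split; [|split]]].
  - intros x y. rewrite (additive_oplus M m x y Ha), Hmeet, (state_tilde M m x Hm).
    unfold Rmin. destruct (Rle_dec (1 - m x) (m y)), (Rle_dec (m x + m y) 1); lra.
  - intros x. now apply state_minus.
  - intros x. now apply state_tilde.
  - now apply additive_zero.
  - apply Hm.
Qed.

(** * State-morphisms are extremal *)

Lemma morphism_odot (M : pseudoMV) (m : M -> R) (x y : M) :
  is_state_morphism m -> m (pmv_odot x y) = Rmax 0 (m x + m y - 1).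
Proof.
  intros (_ & Hp & Hm & Ht & _). unfold pmv_odot. rewrite Ht, Hp, !Hm.
  unfold Rmin, Rmax.
  destruct (Rle_dec (1 - m y + (1 - m x)) 1), (Rle_dec 0 (m x + m y - 1)); lra.
Qed.

Lemma morphism_meet (M : pseudoMV) (m : M -> R) (x y : M) :
  is_state_morphism m -> m (pmv_meet x y) = Rmin (m x) (m y).
Proof.
  intros H. unfold pmv_meet. rewrite (morphism_odot M m _ _ H).
  destruct H as (Hb & Hp & Hm & _). rewrite Hp, Hm.
  pose proof (Hb x). pose proof (Hb y).
  unfold Rmin, Rmax.
  destruct (Rle_dec (1 - m x + m y) 1), (Rle_dec (m x) (m y)); destruct Rle_dec; lra.
Qed.

(** The part of [b] cut off in [a (+) b] has [m]-value zero, because [m (a (+) b) = m a + m b]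
    without truncation; the kernel inclusion transfers this to [s]. *)
Lemma kernel_oplus (M : pseudoMV) (m s : M -> R) (a b : M) :
  is_state m -> is_state_morphism m -> is_state s ->
  (forall x, m x = 0 -> s x = 0) ->
  m a + m b <= 1 -> s (pmv_oplus a b) = s a + s b.
Proof.
  intros Hm Hmm Hs Hk Hab.
  pose proof (proj2 (proj2 Hm) : pmv_additive m) as Ham.
  pose proof (proj2 (proj2 Hs) : pmv_additive s) as Has.
  rewrite (additive_oplus M s a b Has).
  rewrite (additive_diff M s _ _ Has (pmv_meet_ler M (pmv_tilde a) b)).
  rewrite (Hk (pmv_odot (pmv_tilde (pmv_meet (pmv_tilde a) b)) b)); [ring |].
  pose proof (additive_diff M m _ _ Ham (pmv_meet_ler M (pmv_tilde a) b)) as E1.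
  pose proof (additive_oplus M m a b Ham) as E2.
  rewrite (proj1 (proj2 Hmm)), Rmin_left in E2 by exact Hab. lra.
Qed.

(** This is [kernel_oplus] for the complements, whose [m]-values add up to at most [1]. *)
Lemma kernel_odot (M : pseudoMV) (m s : M -> R) (a b : M) :
  is_state m -> is_state_morphism m -> is_state s ->
  (forall x, m x = 0 -> s x = 0) ->
  1 <= m a + m b -> s (pmv_odot a b) = s a + s b - 1.
Proof.
  intros Hm Hmm Hs Hk Hab. unfold pmv_odot.
  rewrite (state_tilde M s _ Hs), (kernel_oplus M m s); auto.
  - rewrite !(state_minus M s _ Hs). ring.
  - rewrite !(state_minus M m _ Hm). lra.
Qed.

(** Here [c] counts the steps made by [(.)], each of which subtracts [1]. The choice of operation
    depends on [m] alone, and the kernel lemmas apply to [m] itself as well as to [s], so both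
    values share the same [c]. *)
Lemma kernel_orbit (M : pseudoMV) (m s : M -> R) (x : M) :
  is_state m -> is_state_morphism m -> is_state s ->
  (forall x, m x = 0 -> s x = 0) ->
  forall n, exists (y : M) (c : R), m y = INR n * m x - c /\ s y = INR n * s x - c.
Proof.
  intros Hm Hmm Hs Hk n. induction n as [|n [y [c [E1 E2]]]].
  - exists pmv_zero, 0. simpl.
    rewrite (additive_zero M m (proj2 (proj2 Hm))), (additive_zero M s (proj2 (proj2 Hs))).
    lra.
  - rewrite S_INR. destruct (Rle_dec (m y + m x) 1) as [L|L].
    + exists (pmv_oplus y x), c.
      rewrite (kernel_oplus M m m), (kernel_oplus M m s); auto. lra.
    + exists (pmv_odot y x), (c + 1).
      rewrite (kernel_odot M m m), (kernel_odot M m s); auto; lra.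
Qed.

Lemma Rabs_small_multiples (d : R) : (forall n, Rabs (INR n * d) <= 1) -> d = 0.
Proof.
  intros H. destruct (Req_dec d 0) as [E|N]; [exact E | exfalso].
  pose proof (Rabs_pos_lt d N) as P.
  destruct (INR_unbounded (/ Rabs d)) as [n Hn].
  specialize (H n). rewrite Rabs_mult, (Rabs_pos_eq (INR n)) in H by apply pos_INR.
  apply Rmult_lt_compat_r with (1 := P) in Hn.
  rewrite Rinv_l in Hn by lra. lra.
Qed.

Lemma morphism_kernel_eq (M : pseudoMV) (m s : M -> R) :
  is_state m -> is_state_morphism m -> is_state s ->
  (forall x, m x = 0 -> s x = 0) -> forall x, s x = m x.
Proof.
  intros Hm Hmm Hs Hk x.
  assert (E : s x - m x = 0); [| lra].
  apply Rabs_small_multiples. intros n.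
  destruct (kernel_orbit M m s x Hm Hmm Hs Hk n) as [y [c [E1 E2]]].
  pose proof (proj1 Hm y). pose proof (proj1 Hs y).
  apply Rabs_le. lra.
Qed.

Lemma morphism_extremal (M : pseudoMV) (m : M -> R) :
  is_state m -> is_state_morphism m -> is_extremal_state m.
Proof.
  intros Hm Hmm l m1 m2 Hl H1 H2 E x.
  (* Both weights are positive and both values nonnegative, so a zero of the mixture is a common
     zero. *)
  assert (K : forall z, m z = 0 -> m1 z = 0 /\ m2 z = 0).
  { intros z Hz. rewrite E in Hz.
    pose proof (proj1 (proj1 H1 z)). pose proof (proj1 (proj1 H2 z)).
    split; nra. }
  rewrite (morphism_kernel_eq M m m1), (morphism_kernel_eq M m m2); auto; apply K.
Qed.

(** * Riesz spaces whose strictly positive elements are strong units *)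

Lemma rs_add_cancel (V : RieszSpace) (a b c : V) : rs_add a c = rs_add b c -> a = b.
Proof.
  intros H. rewrite <- (rs_add0 V a), <- (rs_add0 V b), <- (rs_addN V c), !rs_addA.
  now rewrite H.
Qed.

Lemma rs_scal0 (V : RieszSpace) (a : V) : rs_scal 0 a = rs_zero.
Proof.
  apply rs_add_cancel with (rs_scal 0 a).
  rewrite <- rs_scalDl, Rplus_0_r, rs_addC, rs_add0. reflexivity.
Qed.

Lemma rs_scal_zero (V : RieszSpace) (r : R) : rs_scal r (rs_zero : V) = rs_zero.
Proof.
  apply rs_add_cancel with (rs_scal r rs_zero).
  rewrite <- rs_scalDr, rs_add0, rs_addC, rs_add0. reflexivity.
Qed.

Lemma rs_oppE (V : RieszSpace) (a : V) : rs_opp a = rs_scal (-1) a.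
Proof.
  apply rs_add_cancel with a.
  rewrite rs_addC, rs_addN. rewrite <- (rs_scal1 V a) at 2.
  rewrite <- rs_scalDl. replace (-1 + 1) with 0 by ring. now rewrite rs_scal0.
Qed.

Lemma rs_add_sub (V : RieszSpace) (a b : V) : rs_add (rs_sub a b) b = a.
Proof.
  unfold rs_sub. rewrite <- rs_addA, (rs_addC V (rs_opp b)), rs_addN. apply rs_add0.
Qed.

Lemma rs_le_sub (V : RieszSpace) (a b c : V) :
  rs_le a (rs_sub b c) <-> rs_le (rs_add a c) b.
Proof.
  split; intros H.
  - rewrite <- (rs_add_sub V b c). now apply rs_le_add.
  - apply rs_le_add with (c := rs_opp c) in H.
    now rewrite <- rs_addA, rs_addN, rs_add0 in H.
Qed.

Lemma rs_sub_le (V : RieszSpace) (a b c : V) :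
  rs_le (rs_sub b c) a <-> rs_le b (rs_add a c).
Proof.
  split; intros H.
  - rewrite <- (rs_add_sub V b c). now apply rs_le_add.
  - apply rs_le_add with (c := rs_opp c) in H.
    now rewrite <- rs_addA, rs_addN, rs_add0 in H.
Qed.

Lemma rs_scal_le_l (V : RieszSpace) (r t : R) (a : V) :
  rs_le rs_zero a -> r <= t -> rs_le (rs_scal r a) (rs_scal t a).
Proof.
  intros Ha H. replace t with ((t - r) + r) by ring. rewrite rs_scalDl.
  apply rs_le_scal with (r := t - r) in Ha; [| lra].
  rewrite rs_scal_zero in Ha. apply rs_le_add with (c := rs_scal r a) in Ha.
  now rewrite rs_addC, rs_add0 in Ha.
Qed.

(** If [t < r], the reverse inequality holds as well, so [(r - t) u = 0] and hence [u = 0]. *)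
Lemma rs_scal_le_inv (V : RieszSpace) (r t : R) (u : V) :
  rs_strictly_pos u -> rs_le (rs_scal r u) (rs_scal t u) -> r <= t.
Proof.
  intros [Hu Nu] H. destruct (Rle_dec r t) as [L|L]; [exact L | exfalso].
  apply Nu.
  assert (E : rs_scal r u = rs_scal t u)
    by (apply rs_le_antisym; [exact H | apply rs_scal_le_l; [exact Hu | lra]]).
  assert (E0 : rs_scal (r - t) u = rs_zero).
  { apply rs_add_cancel with (rs_scal t u).
    rewrite <- rs_scalDl, rs_addC, rs_add0. replace (r - t + t) with r by ring. exact E. }
  rewrite <- (rs_scal1 V u), <- (Rinv_l (r - t)) by lra.
  now rewrite <- rs_scalA, E0, rs_scal_zero.
Qed.

Lemma rs_scal_inj (V : RieszSpace) (r t : R) (u : V) :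
  rs_strictly_pos u -> rs_scal r u = rs_scal t u -> r = t.
Proof.
  intros Hu E. apply Rle_antisym; apply (rs_scal_le_inv V _ _ u Hu); rewrite E;
    apply rs_le_refl.
Qed.

Lemma rs_meet_scal (V : RieszSpace) (r t : R) (u : V) :
  rs_le rs_zero u -> rs_meet (rs_scal r u) (rs_scal t u) = rs_scal (Rmin r t) u.
Proof.
  intros Hu. apply rs_le_antisym.
  - unfold Rmin. destruct (Rle_dec r t); [apply rs_meet_l | apply rs_meet_r].
  - apply rs_meet_glb; apply rs_scal_le_l; auto; [apply Rmin_l | apply Rmin_r].
Qed.

Lemma strong_unit_minorant (V : RieszSpace) (a u : V) :
  strong_unit a -> rs_le rs_zero u ->
  exists e, 0 < e /\ rs_le (rs_scal e u) a.
Proof.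
  intros [[Ha _] H] Hu. destruct (H u) as [n Hn].
  (* The successor keeps the inverse meaningful when [n = 0]. *)
  assert (P : 0 < INR (S n)) by (apply lt_0_INR; lia).
  exists (/ INR (S n)). split; [now apply Rinv_0_lt_compat |].
  assert (L : rs_le u (rs_scal (INR (S n)) a)).
  { apply rs_le_trans with (1 := Hn). apply rs_scal_le_l; [exact Ha |].
    rewrite S_INR. lra. }
  apply rs_le_scal with (r := / INR (S n)) in L;
    [| left; now apply Rinv_0_lt_compat].
  now rewrite rs_scalA, Rinv_l, rs_scal1 in L by lra.
Qed.

Lemma rs_le_total (V : RieszSpace) (u : V) :
  strong_unit u -> (forall v : V, rs_strictly_pos v -> strong_unit v) ->
  forall a : V, rs_le rs_zero a \/ rs_le a rs_zero.
Proof.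
  intros [Hu _] hpos a.
  set (p := rs_join a rs_zero). set (q := rs_join (rs_opp a) rs_zero).
  assert (Hp : rs_le rs_zero p) by apply rs_join_r.
  assert (Hq : rs_le rs_zero q) by apply rs_join_r.
  destruct (classic (p = rs_zero)) as [Ep|Np].
  { right. rewrite <- Ep. apply rs_join_l. }
  destruct (classic (q = rs_zero)) as [Eq|Nq].
  { left. assert (L : rs_le (rs_opp a) rs_zero) by (rewrite <- Eq; apply rs_join_l).
    apply rs_le_add with (c := a) in L.
    now rewrite (rs_addC V (rs_opp a)), rs_addN, (rs_addC V rs_zero), rs_add0 in L. }
  exfalso.
  (* Two strong units dominate a common positive multiple of [u], which contradicts
     [p /\ q <= 0]. *)
  destruct (strong_unit_minorant V p u (hpos p (conj Hp Np)) (proj1 Hu)) as [e1 [P1 L1]].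
  destruct (strong_unit_minorant V q u (hpos q (conj Hq Nq)) (proj1 Hu)) as [e2 [P2 L2]].
  set (d := rs_meet p q).
  assert (Hd : rs_le (rs_scal (Rmin e1 e2) u) d).
  { rewrite <- (rs_meet_scal V e1 e2 u (proj1 Hu)). apply rs_meet_glb.
    - apply rs_le_trans with (2 := L1). apply rs_meet_l.
    - apply rs_le_trans with (2 := L2). apply rs_meet_r. }
  (* One half of the identity [p = a + q] between positive and negative part. *)
  assert (Hpq : rs_le p (rs_add a q)).
  { apply rs_join_lub.
    - rewrite <- (rs_add0 V a) at 1. rewrite (rs_addC V a rs_zero), (rs_addC V a q).
      now apply rs_le_add.
    - rewrite <- (rs_addN V a), (rs_addC V a (rs_opp a)), (rs_addC V a q).
      apply rs_le_add, rs_join_l. }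
  (* Both [-a] and [0] lie below [q - d], hence so does their join [q]; this forces [d <= 0]. *)
  assert (Hqd : rs_le q (rs_sub q d)).
  { apply rs_join_lub; apply rs_le_sub.
    - apply rs_le_trans with (rs_add (rs_opp a) p).
      + rewrite !(rs_addC V (rs_opp a)). apply rs_le_add, rs_meet_l.
      + apply rs_le_add with (c := rs_opp a) in Hpq.
        rewrite (rs_addC V a q), <- rs_addA, rs_addN, rs_add0 in Hpq.
        now rewrite rs_addC.
    - rewrite rs_addC, rs_add0. apply rs_meet_r. }
  assert (Hd0 : rs_le d rs_zero).
  { apply rs_le_sub in Hqd. apply rs_le_add with (c := rs_opp q) in Hqd.
    now rewrite (rs_addC V q d), <- rs_addA, rs_addN, rs_add0 in Hqd. }
  assert (L : Rmin e1 e2 <= 0).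
  { apply (rs_scal_le_inv V _ _ u Hu). rewrite rs_scal0.
    now apply rs_le_trans with d. }
  revert L. unfold Rmin. destruct (Rle_dec e1 e2); lra.
Qed.

(** The coefficient is the supremum [r] of all [t] with [t u <= a]. If [a] differed from [r u],
    totality would make [a - r u] or its opposite a strong unit, dominating some [e u] with
    [e > 0]. *)
Lemma rs_real_multiple (V : RieszSpace) (u : V) :
  strong_unit u -> (forall v : V, rs_strictly_pos v -> strong_unit v) ->
  forall a : V, rs_le rs_zero a -> exists r, a = rs_scal r u.
Proof.
  intros hu hpos a Ha. pose proof (proj1 hu) as Hu.
  destruct (proj2 hu a) as [N HN].
  destruct (completeness (fun r => rs_le (rs_scal r u) a)) as [r [Hub Hlub]].
  - exists (INR N). intros r Hr. apply (rs_scal_le_inv V _ _ u Hu).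
    now apply rs_le_trans with a.
  - exists 0. now rewrite rs_scal0.
  - exists r.
    apply NNPP. intros Na.
    assert (Nd : rs_sub a (rs_scal r u) <> rs_zero).
    { intros E. apply Na. rewrite <- (rs_add_sub V a (rs_scal r u)), E.
      now rewrite rs_addC, rs_add0. }
    destruct (rs_le_total V u hu hpos (rs_sub a (rs_scal r u))) as [L|L].
    (* In this case [e + r] belongs to the set, above its supremum. *)
    + destruct (strong_unit_minorant V _ u (hpos _ (conj L Nd)) (proj1 Hu))
        as [e [Pe Le]].
      apply rs_le_sub in Le. rewrite <- rs_scalDl in Le.
      specialize (Hub _ Le). lra.
    + assert (L' : rs_le rs_zero (rs_sub (rs_scal r u) a)).
      { apply rs_le_sub. rewrite rs_addC, rs_add0.
        apply rs_sub_le in L. now rewrite rs_addC, rs_add0 in L. }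
      assert (Nd' : rs_sub (rs_scal r u) a <> rs_zero).
      { intros E. apply Na. rewrite <- (rs_add_sub V (rs_scal r u) a), E.
        now rewrite rs_addC, rs_add0. }
      destruct (strong_unit_minorant V _ u (hpos _ (conj L' Nd')) (proj1 Hu))
        as [e [Pe Le]].
      (* In this case [r - e] is a smaller upper bound. *)
      assert (B : r <= r - e); [| lra].
      apply Hlub. intros t Ht.
      apply rs_le_sub in Le.
      assert (K : e + t <= r); [| lra].
      apply (rs_scal_le_inv V _ _ u Hu). rewrite rs_scalDl.
      apply rs_le_trans with (2 := Le). rewrite !(rs_addC V (rs_scal e u)).
      now apply rs_le_add.
Qed.

(** * Transfer between [V]-valued and real-valued states *)

(** The map [r |-> r u] is additive and, [u] being strictly positive, preserves and reflects the
    order, so each clause passes through it in both directions. *)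
Lemma RState_scal (V : RieszSpace) (u : V) (M : pseudoMV) (s : M -> V) (m : M -> R) :
  rs_strictly_pos u -> (forall x, s x = rs_scal (m x) u) ->
  (is_RState u s <-> is_state m).
Proof.
  intros Hu E. split; intros [Hb [H1 Ha]]; (split; [|split]).
  - intros x. specialize (Hb x). rewrite E in Hb. split.
    + apply (rs_scal_le_inv V _ _ u Hu). rewrite rs_scal0. apply Hb.
    + apply (rs_scal_le_inv V _ _ u Hu). rewrite rs_scal1. apply Hb.
  - apply (rs_scal_inj V _ _ u Hu). now rewrite <- E, rs_scal1.
  - intros x y D. apply (rs_scal_inj V _ _ u Hu). rewrite rs_scalDl, <- !E. now apply Ha.
  - intros x. rewrite E. split.
    + rewrite <- (rs_scal0 V u). apply rs_scal_le_l; [apply Hu | apply Hb].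
    + rewrite <- (rs_scal1 V u) at 2. apply rs_scal_le_l; [apply Hu | apply Hb].
  - rewrite E, H1. apply rs_scal1.
  - intros x y D. rewrite !E, <- rs_scalDl. now rewrite Ha.
Qed.

Lemma rs_sub_unit_scal (V : RieszSpace) (u : V) (r : R) :
  rs_sub u (rs_scal r u) = rs_scal (1 - r) u.
Proof.
  unfold rs_sub. rewrite rs_oppE, rs_scalA. rewrite <- (rs_scal1 V u) at 1.
  rewrite <- rs_scalDl. f_equal. ring.
Qed.

Lemma rs_meet_add_unit (V : RieszSpace) (u : V) (r t : R) :
  rs_le rs_zero u ->
  rs_meet (rs_add (rs_scal r u) (rs_scal t u)) u = rs_scal (Rmin (r + t) 1) u.
Proof.
  intros Hu. rewrite <- (rs_meet_scal V _ _ u Hu), rs_scalDl, rs_scal1. reflexivity.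
Qed.

(** The clause for [(+)] passes through [r |-> r u], which sends truncation at [1] to the meet with
    [u]; complements and constants are computed from [m] being a state. *)
Lemma RState_morphism_scal (V : RieszSpace) (u : V) (M : pseudoMV) (s : M -> V) (m : M -> R) :
  rs_strictly_pos u -> is_state m -> (forall x, s x = rs_scal (m x) u) ->
  (is_RState_morphism u s <-> is_state_morphism m).
Proof.
  intros Hu Hm E.
  pose proof (proj2 (RState_scal V u M s m Hu E) Hm) as Hs.
  split; intros (_ & Hp & _).
  - split; [apply Hm |]. split; [|split; [|split; [|split]]].
    + intros x y. apply (rs_scal_inj V _ _ u Hu).
      rewrite <- (rs_meet_add_unit V u _ _ (proj1 Hu)), <- !E. apply Hp.
    + intros x. now apply state_minus.
    + intros x. now apply state_tilde.
    + exact (additive_zero M m (proj2 (proj2 Hm))).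
    + apply Hm.
  - split; [apply Hs |]. split; [|split; [|split; [|split]]].
    + intros x y. rewrite !E, (rs_meet_add_unit V u _ _ (proj1 Hu)). now rewrite Hp.
    + intros x. rewrite !E, (state_minus M m x Hm). now rewrite rs_sub_unit_scal.
    + intros x. rewrite !E, (state_tilde M m x Hm). now rewrite rs_sub_unit_scal.
    + rewrite E, (additive_zero M m (proj2 (proj2 Hm))). apply rs_scal0.
    + apply Hs.
Qed.

Lemma RState_meet_scal (V : RieszSpace) (u : V) (M : pseudoMV) (s : M -> V) (m : M -> R) :
  rs_strictly_pos u -> (forall x, s x = rs_scal (m x) u) ->
  ((forall x y, s (pmv_meet x y) = rs_meet (s x) (s y)) <->
   (forall x y, m (pmv_meet x y) = Rmin (m x) (m y))).
Proof.
  intros Hu E. split; intros H x y.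
  - apply (rs_scal_inj V _ _ u Hu).
    rewrite <- (rs_meet_scal V _ _ u (proj1 Hu)), <- !E. apply H.
  - rewrite !E, (rs_meet_scal V _ _ u (proj1 Hu)). now rewrite H.
Qed.

Lemma rs_comb_scal (V : RieszSpace) (u : V) (M : pseudoMV) (s1 s2 : M -> V)
    (m1 m2 : M -> R) (l : R) (x : M) :
  s1 x = rs_scal (m1 x) u -> s2 x = rs_scal (m2 x) u ->
  rs_comb l s1 s2 x = rs_scal (l * m1 x + (1 - l) * m2 x) u.
Proof.
  intros E1 E2. unfold rs_comb. now rewrite E1, E2, !rs_scalA, <- rs_scalDl.
Qed.

Lemma state_comb (M : pseudoMV) (m1 m2 : M -> R) (l : R) :
  0 <= l <= 1 -> is_state m1 -> is_state m2 ->
  is_state (fun x => l * m1 x + (1 - l) * m2 x).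
Proof.
  intros Hl (B1 & U1 & A1) (B2 & U2 & A2). split; [|split].
  - intros x. specialize (B1 x). specialize (B2 x). split; nra.
  - rewrite U1, U2. ring.
  - intros x y D. rewrite A1, A2 by exact D. ring.
Qed.

(** On states this is [s |-> m_s]; elsewhere its values are junk. *)
Definition real_part {M : pseudoMV} {V : RieszSpace} (u : V) (s : M -> V) (x : M) : R :=
  epsilon (inhabits 0) (fun r => s x = rs_scal r u).

Lemma real_partE (V : RieszSpace) (u : V) (M : pseudoMV) (s : M -> V) :
  strong_unit u -> (forall v : V, rs_strictly_pos v -> strong_unit v) ->
  is_RState u s -> forall x, s x = rs_scal (real_part u s x) u.
Proof.
  intros hu hpos Hs x. unfold real_part. apply epsilon_spec.
  apply (rs_real_multiple V u hu hpos). apply Hs.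
Qed.

Lemma real_part_scal (V : RieszSpace) (u : V) (M : pseudoMV) (s : M -> V) (m : M -> R) :
  rs_strictly_pos u -> (forall x, s x = rs_scal (m x) u) ->
  forall x, real_part u s x = m x.
Proof.
  intros Hu E x. apply (rs_scal_inj V _ _ u Hu). rewrite <- E. symmetry.
  unfold real_part. apply epsilon_spec. now exists (m x).
Qed.

(** From left to right, a real decomposition is multiplied by [u]. From right to left, the arbitrary
    [V]-valued states of a decomposition are first written as multiples of [u], by [real_partE]. *)
Lemma extremal_RState_scal (V : RieszSpace) (u : V) (M : pseudoMV) (s : M -> V) (m : M -> R) :
  strong_unit u -> (forall v : V, rs_strictly_pos v -> strong_unit v) ->
  is_RState u s -> (forall x, s x = rs_scal (m x) u) ->
  (is_extremal_RState u s <-> is_extremal_state m).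
Proof.
  intros hu hpos Hs E. pose proof (proj1 hu) as Hu. split.
  - intros [_ He] l m1 m2 Hl H1 H2 Em x. apply (rs_scal_inj V _ _ u Hu).
    apply (He l (fun x => rs_scal (m1 x) u) (fun x => rs_scal (m2 x) u)); auto.
    + now apply (RState_scal V u M _ m1).
    + now apply (RState_scal V u M _ m2).
    + intros z. rewrite E, Em. symmetry. now apply rs_comb_scal.
  - intros He. split; [exact Hs |]. intros l s1 s2 Hl H1 H2 Ec x.
    pose proof (real_partE V u M s1 hu hpos H1) as E1.
    pose proof (real_partE V u M s2 hu hpos H2) as E2.
    rewrite E1, E2. f_equal.
    apply (He l); auto.
    + now apply (RState_scal V u M s1).
    + now apply (RState_scal V u M s2).
    + intros z. apply (rs_scal_inj V _ _ u Hu). rewrite <- E, Ec. now apply rs_comb_scal.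
Qed.

Theorem theorem3p13 (V : RieszSpace) (u : V) (M : pseudoMV)
  (hu : strong_unit u)
  (hpos : forall v : V, rs_strictly_pos v -> strong_unit v) :
  (* states give (V,u)-states *)
  (forall m : M -> R, is_state m -> is_RState u (fun x => rs_scal (m x) u)) /\
  (* every (V,u)-state is m_s(.) u for a unique state m_s *)
  (forall s : M -> V, is_RState u s ->
     exists m : M -> R, is_state m /\ (forall x, s x = rs_scal (m x) u) /\
       forall m' : M -> R, is_state m' -> (forall x, s x = rs_scal (m' x) u) ->
         forall x, m' x = m x) /\
  (* s |-> m_s is an affine bijection from (V,u)-states onto states *)
  (exists Phi : (M -> V) -> (M -> R),
     (forall s, is_RState u s -> is_state (Phi s) /\ forall x, s x = rs_scal (Phi s x) u) /\
     (forall s1 s2, is_RState u s1 -> is_RState u s2 ->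
        (forall x, Phi s1 x = Phi s2 x) -> forall x, s1 x = s2 x) /\
     (forall m, is_state m -> exists s, is_RState u s /\ forall x, Phi s x = m x) /\
     (forall (l : R) s1 s2, 0 <= l <= 1 -> is_RState u s1 -> is_RState u s2 ->
        is_RState u (rs_comb l s1 s2) /\
        forall x, Phi (rs_comb l s1 s2) x = l * Phi s1 x + (1 - l) * Phi s2 x)) /\
  (* characterizations of extremal (V,u)-states *)
  (forall s : M -> V, is_RState u s ->
     (is_extremal_RState u s <-> is_RState_morphism u s) /\
     (is_RState_morphism u s <->
        forall x y : M, s (pmv_meet x y) = rs_meet (s x) (s y)) /\
     ((forall x y : M, s (pmv_meet x y) = rs_meet (s x) (s y)) <->
        forall m : M -> R, is_state m -> (forall x, s x = rs_scal (m x) u) ->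
          is_state_morphism m)).
Proof.
  pose proof (proj1 hu) as Hu.
  assert (RP : forall s : M -> V, is_RState u s ->
            is_state (real_part u s) /\ forall x, s x = rs_scal (real_part u s x) u).
  { intros s Hs. pose proof (real_partE V u M s hu hpos Hs) as E.
    split; [| exact E]. now apply (RState_scal V u M s). }
  split; [|split; [|split]].
  - intros m Hm. now apply (RState_scal V u M _ m).
  - intros s Hs. destruct (RP s Hs) as [Hm E].
    exists (real_part u s). split; [exact Hm | split; [exact E |]].
    intros m' _ E' x. symmetry. now apply real_part_scal.
  - exists (real_part u). split; [exact RP | split; [|split]].
    + intros s1 s2 H1 H2 E x.
      now rewrite (proj2 (RP s1 H1)), (proj2 (RP s2 H2)), E.
    + intros m Hm. exists (fun x => rs_scal (m x) u). split.
      * now apply (RState_scal V u M _ m).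
      * now apply real_part_scal.
    + intros l s1 s2 Hl H1 H2.
      destruct (RP s1 H1) as [M1 E1]. destruct (RP s2 H2) as [M2 E2].
      assert (E : forall x, rs_comb l s1 s2 x
                = rs_scal (l * real_part u s1 x + (1 - l) * real_part u s2 x) u)
        by (intros x; now apply rs_comb_scal).
      split.
      * apply (RState_scal V u M _ _ Hu E). now apply state_comb.
      * exact (real_part_scal V u M _ _ Hu E).
  - intros s Hs. destruct (RP s Hs) as [Hm E].
    (* The first three conditions become conditions on [real_part u s]; the last keeps its
       quantifier over [m]. *)
    rewrite (extremal_RState_scal V u M s _ hu hpos Hs E).
    rewrite (RState_morphism_scal V u M s _ Hu Hm E).
    rewrite (RState_meet_scal V u M s _ Hu E).
    assert (meet_morphism := state_meet_morphism M _ Hm).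
    split; [|split]; split.
    + intros He. apply meet_morphism. intros x y. now apply extremal_state_meet.
    + now apply morphism_extremal.
    + intros Hmm x y. now apply morphism_meet.
    + exact meet_morphism.
    (* Preservation of meets passes from [real_part u s] up to [s], and down again to any [m']
       representing [s]. *)
    + intros H m' Hm' E'. apply state_meet_morphism; [exact Hm' |].
      now apply (RState_meet_scal V u M s m' Hu E'), (RState_meet_scal V u M s _ Hu E).
    + intros H x y. now apply morphism_meet, H.
Qed.
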